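(* There is an equivalence of 2-categories between the 2-category of unitary (equivalently, inner product) categories, unitary functors and achiral transformations, and its full sub-2-category $\dagger\text{-}\mathsf{Cat}$ of dagger categories.
   Context: Composition is written in diagrammatic order: $fg$ means first $f$, then $g$. An involutive category $(\mathbb{X},(-)^\dagger,\iota)$ is a category $\mathbb{X}$ with a functor $(-)^\dagger:\mathbb{X}^{\mathrm{op}}\to\mathbb{X}$ and a natural isomorphism $\iota_X:X\to X^{\dagger\dagger}$ such that $\iota_{X^\dagger}(\iota_X)^\dagger=1_{X^\dagger}$. A dagger category ($\dagger$-category) is an involutive category with $X^\dagger=X$ on objects and $\iota$ the identity. An involutive functor $(F,\gamma):(\mathbb{X},(-)^\dagger,\iota)\to(\mathbb{Y},(-)^\ddagger,\iota')$ is a functor $F$ with a natural isomorphism $\gamma_X:F(X^\dagger)\to F(X)^\ddagger$ (the preservator) such that $F(\iota_X)\gamma_{X^\dagger}=\iota'_{F(X)}(\gamma_X)^\ddagger$. Composition: $(F,\gamma)(G,\gamma')=(FG,G(\gamma)\gamma')$, with $FG$ meaning first $F$, then $G$. An achiral transformation $\alpha:(F,\gamma)\to(G,\gamma')$ of involutive functors $\mathbb{X}\to\mathbb{Y}$ is a natural transformation $\alpha:F\to G$ such that for all $X$: $\gamma_{X^\dagger}=\alpha_{X^{\dagger\dagger}}\,\gamma'_{X^\dagger}\,(\alpha_{X^\dagger})^\ddagger$ and $(\gamma_X)^\ddagger=(\alpha_X)^{\ddagger\ddagger}\,(\gamma'_X)^\ddagger\,(\alpha_{X^\dagger})^\ddagger$.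 They compose and whisker as natural transformations. A unitary category is an involutive category with a family of isomorphisms $\varphi_X:X\to X^\dagger$ (not assumed natural) such that $\varphi_{X^\dagger}=(\varphi_X^{-1})^\dagger$ and $\varphi_X\varphi_{X^\dagger}=\iota_X$. An inner product category is the same thing, via $\langle f|g\rangle=f\varphi_Xg^\dagger$ for $f:A\to X$, $g:B\to X$, and $\varphi_A=\langle 1_A|1_A\rangle$. A unitary functor between unitary categories is an involutive functor $(F,\gamma)$ with $F(\varphi_X)\gamma_X=\varphi_{F(X)}$ for all $X$. Dagger categories are regarded as unitary categories with $\varphi_X=1_X$; $\dagger\text{-}\mathsf{Cat}$ is the full sub-2-category on these. *)

(* Defs.v *)
From Stdlib Require Import FunctionalExtensionality ProofIrrelevance.

Set Implicit Arguments.
Unset Strict Implicit.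
Unset Printing Implicit Defensive.

Definition cast2 {T : Type} (P : T -> T -> Type) {x x' y y' : T}
    (p : x = x') (q : y = y') (m : P x y) : P x' y' :=
  match p in _ = u, q in _ = v return P u v with
  | eq_refl, eq_refl => m
  end.
Arguments cast2 {T} P {x x' y y'} p q m.

Lemma cast2_id T (P : T -> T -> Type) (x y : T) (p : x = x) (q : y = y)
    (m : P x y) : cast2 P p q m = m.
Proof.
rewrite (proof_irrelevance _ p eq_refl), (proof_irrelevance _ q eq_refl).
reflexivity.
Qed.

Lemma cast2_trans T (P : T -> T -> Type) (x x' x'' y y' y'' : T)
    (p : x = x') (p' : x' = x'') (q : y = y') (q' : y' = y'') (m : P x y) :
  cast2 P (eq_trans p p') (eq_trans q q') m = cast2 P p' q' (cast2 P p q m).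
Proof. destruct p', q', p, q; reflexivity. Qed.

#[local] Obligation Tactic := intros.

(** Composition is written in diagrammatic order throughout: [f ;; g] is first
    [f], then [g]. *)
Record Category := {
  ob :> Type;
  hom : ob -> ob -> Type;
  idm : forall a, hom a a;
  comp : forall a b c, hom a b -> hom b c -> hom a c;
  comp_assoc : forall a b c d (f : hom a b) (g : hom b c) (h : hom c d),
    comp f (comp g h) = comp (comp f g) h;
  id_comp : forall a b (f : hom a b), comp (idm a) f = f;
  comp_id : forall a b (f : hom a b), comp f (idm b) = f
}.
Arguments idm {C} a : rename.
Arguments comp {C a b c} f g : rename.

Notation "f ;; g" := (comp f g) (at level 50, left associativity).

Record Iso (C : Category) (a b : C) := {
  iso_to :> hom a b;
  iso_from : hom b a;
  iso_to_from : iso_to ;; iso_from = idm a;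
  iso_from_to : iso_from ;; iso_to = idm b
}.

Lemma iso_eq (C : Category) (a b : C) (i j : Iso a b) :
  iso_to i = iso_to j -> i = j.
Proof.
intros e; destruct i as [f g fg gf], j as [f' g' fg' gf']; simpl in e; subst f'.
assert (g = g') as e.
{ rewrite <- (comp_id g), <- fg', comp_assoc, gf; apply id_comp. }
subst g'; f_equal; apply proof_irrelevance.
Qed.

Lemma id_iso_subproof (C : Category) (a : C) : idm a ;; idm a = idm a.
Proof. apply id_comp. Qed.

Definition id_iso (C : Category) (a : C) : Iso a a :=
  {| iso_to := idm a; iso_from := idm a;
     iso_to_from := id_iso_subproof a; iso_from_to := id_iso_subproof a |}.

Program Definition comp_iso (C : Category) (a b c : C)
    (i : Iso a b) (j : Iso b c) : Iso a c :=
  {| iso_to := i ;; j; iso_from := iso_from j ;; iso_from i |}.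
Next Obligation.
simpl; rewrite comp_assoc, <- (comp_assoc (iso_to i)), iso_to_from, comp_id.
apply iso_to_from.
Qed.
Next Obligation.
simpl; rewrite comp_assoc, <- (comp_assoc (iso_from j)), iso_from_to, comp_id.
apply iso_from_to.
Qed.

(** A morphism between objects [a] and [b] can only be an identity when
    [a = b]; the identity of [a] is then transported along that equality. *)
Definition is_identity (C : Category) (a b : C) (f : hom a b) : Prop :=
  exists e : a = b, f = match e in _ = y return hom a y with eq_refl => idm a end.

Record Functor (C D : Category) := {
  fobj :> C -> D;
  fmap : forall a b, hom a b -> hom (fobj a) (fobj b);
  fmap_id : forall a, fmap (idm a) = idm (fobj a);
  fmap_comp : forall a b c (f : hom a b) (g : hom b c),
    fmap (f ;; g) = fmap f ;; fmap g
}.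
Arguments fmap {C D} F {a b} f : rename.

Definition id_functor (C : Category) : Functor C C :=
  {| fobj := fun a => a; fmap := fun _ _ f => f;
     fmap_id := fun _ => eq_refl; fmap_comp := fun _ _ _ _ _ => eq_refl |}.

Program Definition comp_functor (C D E : Category)
    (F : Functor C D) (G : Functor D E) : Functor C E :=
  {| fobj := fun a => G (F a); fmap := fun _ _ f => fmap G (fmap F f) |}.
Next Obligation. simpl; rewrite !fmap_id; reflexivity. Qed.
Next Obligation. simpl; rewrite !fmap_comp; reflexivity. Qed.

Program Definition map_iso (C D : Category) (F : Functor C D) (a b : C)
    (i : Iso a b) : Iso (F a) (F b) :=
  {| iso_to := fmap F i; iso_from := fmap F (iso_from i) |}.
Next Obligation. simpl; rewrite <- fmap_comp, iso_to_from; apply fmap_id. Qed.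
Next Obligation. simpl; rewrite <- fmap_comp, iso_from_to; apply fmap_id. Qed.

Definition op (C : Category) : Category :=
  {| ob := ob C;
     hom := fun a b => @hom C b a;
     idm := fun a => @idm C a;
     comp := fun _ _ _ f g => @comp C _ _ _ g f;
     comp_assoc := fun _ _ _ _ f g h => eq_sym (@comp_assoc C _ _ _ _ h g f);
     id_comp := fun _ _ f => @comp_id C _ _ f;
     comp_id := fun _ _ f => @id_comp C _ _ f |}.

Definition cmap (C D : Category) (F : Functor (op C) D) (a b : C)
    (f : @hom C a b) : hom (F b) (F a) := @fmap (op C) D F b a f.

Lemma cmap_id (C D : Category) (F : Functor (op C) D) (a : C) :
  cmap F (@idm C a) = idm (F a).
Proof. exact (fmap_id F a). Qed.

Lemma cmap_comp (C D : Category) (F : Functor (op C) D) (a b c : C)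
    (f : @hom C a b) (g : @hom C b c) :
  cmap F (f ;; g) = cmap F g ;; cmap F f.
Proof. exact (@fmap_comp (op C) D F c b a g f). Qed.

Program Definition prod_cat (C D : Category) : Category :=
  {| ob := (ob C * ob D)%type;
     hom := fun x y => (hom (fst x) (fst y) * hom (snd x) (snd y))%type;
     idm := fun x => (idm (fst x), idm (snd x));
     comp := fun _ _ _ f g => (fst f ;; fst g, snd f ;; snd g) |}.
Next Obligation. simpl; f_equal; apply comp_assoc. Qed.
Next Obligation. destruct f; simpl; f_equal; apply id_comp. Qed.
Next Obligation. destruct f; simpl; f_equal; apply comp_id. Qed.

(** Strict 2-categories, as categories enriched in categories: [hom2 A B] is the
    category of 1-cells and 2-cells from [A] to [B], under vertical composition,
    and [hcomp2] is horizontal composition, in diagrammatic order. Its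
    associativity and unit laws on 2-cells hold modulo transport along the
    corresponding equalities of 1-cells. *)
Record TwoCategory := {
  ob2 :> Type;
  hom2 : ob2 -> ob2 -> Category;
  id2 : forall A, hom2 A A;
  hcomp2 : forall A B C, Functor (prod_cat (hom2 A B) (hom2 B C)) (hom2 A C);

  comp1_assoc : forall A B C D (f : hom2 A B) (g : hom2 B C) (h : hom2 C D),
    hcomp2 A C D (hcomp2 A B C (f, g), h) = hcomp2 A B D (f, hcomp2 B C D (g, h));
  id_comp1 : forall A B (f : hom2 A B), hcomp2 A A B (id2 A, f) = f;
  comp1_id : forall A B (f : hom2 A B), hcomp2 A B B (f, id2 B) = f;

  hcomp_assoc : forall A B C D (f f' : hom2 A B) (g g' : hom2 B C)
      (h h' : hom2 C D) (s : hom f f') (t : hom g g') (u : hom h h'),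
    cast2 (@hom (hom2 A D)) (comp1_assoc f g h) (comp1_assoc f' g' h')
      (fmap (hcomp2 A C D) (a := (_, _)) (b := (_, _))
        (fmap (hcomp2 A B C) (a := (_, _)) (b := (_, _)) (s, t), u))
    = fmap (hcomp2 A B D) (a := (_, _)) (b := (_, _))
        (s, fmap (hcomp2 B C D) (a := (_, _)) (b := (_, _)) (t, u));
  id_hcomp : forall A B (f f' : hom2 A B) (s : hom f f'),
    cast2 (@hom (hom2 A B)) (id_comp1 f) (id_comp1 f')
      (fmap (hcomp2 A A B) (a := (_, _)) (b := (_, _)) (idm (id2 A), s)) = s;
  hcomp_id : forall A B (f f' : hom2 A B) (s : hom f f'),
    cast2 (@hom (hom2 A B)) (comp1_id f) (comp1_id f')
      (fmap (hcomp2 A B B) (a := (_, _)) (b := (_, _)) (s, idm (id2 B))) = s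
}.
Arguments id2 {K} A : rename.

Definition comp1 (K : TwoCategory) (A B C : K) (f : hom2 A B) (g : hom2 B C) :
  hom2 A C := hcomp2 A B C (f, g).

Definition hcomp (K : TwoCategory) (A B C : K) (f f' : hom2 A B)
    (g g' : hom2 B C) (s : hom f f') (t : hom g g') :
    hom (comp1 f g) (comp1 f' g') :=
  fmap (hcomp2 A B C) (a := (f, g)) (b := (f', g')) (s, t).

Record TwoFunctor (K L : TwoCategory) := {
  fobj2 :> K -> L;
  fhom2 : forall A B, Functor (hom2 A B) (hom2 (fobj2 A) (fobj2 B));
  fhom2_id : forall A, fhom2 A A (id2 A) = id2 (fobj2 A);
  fhom2_comp1 : forall A B C (f : hom2 A B) (g : hom2 B C),
    fhom2 A C (comp1 f g) = comp1 (fhom2 A B f) (fhom2 B C g);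
  fhom2_hcomp : forall A B C (f f' : hom2 A B) (g g' : hom2 B C)
      (s : hom f f') (t : hom g g'),
    cast2 (@hom (hom2 (fobj2 A) (fobj2 C)))
      (fhom2_comp1 f g) (fhom2_comp1 f' g') (fmap (fhom2 A C) (hcomp s t))
    = hcomp (fmap (fhom2 A B) s) (fmap (fhom2 B C) t)
}.
Arguments fhom2 {K L} F {A B} : rename.

Definition id_2functor (K : TwoCategory) : TwoFunctor K K :=
  {| fobj2 := fun A => A;
     fhom2 := fun A B => id_functor (hom2 A B);
     fhom2_id := fun _ => eq_refl;
     fhom2_comp1 := fun _ _ _ _ _ => eq_refl;
     fhom2_hcomp := fun _ _ _ _ _ _ _ _ _ => eq_refl |}.

Lemma fmap_cast2 (C D : Category) (F : Functor C D) (a a' b b' : C)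
    (p : a = a') (q : b = b') (f : hom a b) :
  fmap F (cast2 (@hom C) p q f)
  = cast2 (@hom D) (f_equal F p) (f_equal F q) (fmap F f).
Proof. destruct p, q; reflexivity. Qed.

Program Definition comp_2functor (K L M : TwoCategory)
    (F : TwoFunctor K L) (G : TwoFunctor L M) : TwoFunctor K M :=
  {| fobj2 := fun A => G (F A);
     fhom2 := fun A B => comp_functor (fhom2 F (A := A) (B := B)) (fhom2 G);
     fhom2_comp1 := fun A B C f g =>
       eq_trans (f_equal (fhom2 G) (fhom2_comp1 F f g))
                (fhom2_comp1 G (fhom2 F f) (fhom2 F g)) |}.
Next Obligation. simpl; rewrite !fhom2_id; reflexivity. Qed.
Next Obligation.
simpl; rewrite cast2_trans, <- fmap_cast2, !fhom2_hcomp; reflexivity.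
Qed.

Record TwoNatTrans (K L : TwoCategory) (F G : TwoFunctor K L) := {
  ncomp :> forall A : K, hom2 (F A) (G A);
  nat1 : forall A B (f : hom2 A B),
    comp1 (fhom2 F f) (ncomp B) = comp1 (ncomp A) (fhom2 G f);
  nat2 : forall A B (f f' : hom2 A B) (s : hom f f'),
    cast2 (@hom (hom2 (F A) (G B))) (nat1 f) (nat1 f')
      (hcomp (fmap (fhom2 F) s) (idm (ncomp B)))
    = hcomp (idm (ncomp A)) (fmap (fhom2 G) s)
}.

Definition is_2nat_iso (K L : TwoCategory) (F G : TwoFunctor K L)
    (t : TwoNatTrans F G) : Prop :=
  exists t' : TwoNatTrans G F,
    forall A, comp1 (t A) (t' A) = id2 (F A) /\ comp1 (t' A) (t A) = id2 (G A).

Definition is_2equivalence (K L : TwoCategory) (F : TwoFunctor K L) : Prop :=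
  exists (G : TwoFunctor L K)
         (unit : TwoNatTrans (id_2functor K) (comp_2functor F G))
         (counit : TwoNatTrans (comp_2functor G F) (id_2functor L)),
    is_2nat_iso unit /\ is_2nat_iso counit.

Definition full_sub2cat (K : TwoCategory) (P : K -> Prop) : TwoCategory :=
  {| ob2 := {A : K | P A};
     hom2 := fun A B => hom2 (proj1_sig A) (proj1_sig B);
     id2 := fun A => id2 (proj1_sig A);
     hcomp2 := fun A B C => hcomp2 (proj1_sig A) (proj1_sig B) (proj1_sig C);
     comp1_assoc := fun _ _ _ _ => @comp1_assoc K _ _ _ _;
     id_comp1 := fun _ _ => @id_comp1 K _ _;
     comp1_id := fun _ _ => @comp1_id K _ _;
     hcomp_assoc := fun _ _ _ _ => @hcomp_assoc K _ _ _ _;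
     id_hcomp := fun _ _ => @id_hcomp K _ _;
     hcomp_id := fun _ _ => @hcomp_id K _ _ |}.

Definition full_sub2cat_incl (K : TwoCategory) (P : K -> Prop) :
    TwoFunctor (full_sub2cat P) K :=
  @Build_TwoFunctor (full_sub2cat P) K
    (fun A => proj1_sig A)
    (fun A B => id_functor (hom2 (proj1_sig A) (proj1_sig B)))
    (fun _ => eq_refl)
    (fun _ _ _ _ _ => eq_refl)
    (fun _ _ _ _ _ _ _ _ _ => eq_refl).

Record InvolutiveCategory := {
  icat :> Category;
  dag : Functor (op icat) icat;
  iota : forall X : icat, @Iso icat X (dag (dag X));
  iota_nat : forall (X Y : icat) (f : hom X Y),
    f ;; iota Y = iota X ;; cmap dag (cmap dag f);
  iota_dag : forall X : icat, iota (dag X) ;; cmap dag (iota X) = idm (dag X)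
}.
Arguments dag {I} : rename.

Notation "X ^†" := (fobj dag X) (at level 1, format "X ^†").

Definition dagm (I : InvolutiveCategory) (X Y : I) (f : hom X Y) :
  @hom I (Y^†) (X^†) := cmap dag f.

Lemma dagm_id (I : InvolutiveCategory) (X : I) : dagm (idm X) = idm (X^†).
Proof. apply cmap_id. Qed.

Lemma dagm_comp (I : InvolutiveCategory) (X Y Z : I) (f : hom X Y)
    (g : hom Y Z) : dagm (f ;; g) = dagm g ;; dagm f.
Proof. apply cmap_comp. Qed.

Record InvolutiveFunctor (I J : InvolutiveCategory) := {
  ifun :> Functor I J;
  pres : forall X : I, @Iso J (ifun (X^†)) ((ifun X)^†);
  pres_nat : forall (X Y : I) (f : hom X Y),
    fmap ifun (dagm f) ;; pres X = pres Y ;; dagm (fmap ifun f);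
  pres_iota : forall X : I,
    fmap ifun (iota X) ;; pres (X^†) = iota (ifun X) ;; dagm (pres X)
}.

Program Definition id_ifun (I : InvolutiveCategory) : InvolutiveFunctor I I :=
  {| ifun := id_functor I; pres := fun X => @id_iso I (X^†) |}.
Next Obligation. simpl; rewrite comp_id, id_comp; reflexivity. Qed.
Next Obligation. simpl; rewrite dagm_id, !comp_id; reflexivity. Qed.

Program Definition comp_ifun (I J K : InvolutiveCategory)
    (F : InvolutiveFunctor I J) (G : InvolutiveFunctor J K) :
    InvolutiveFunctor I K :=
  {| ifun := comp_functor F G;
     pres := fun X => comp_iso (map_iso G (pres F X)) (pres G (F X)) |}.
Next Obligation.
simpl; rewrite comp_assoc, <- fmap_comp, pres_nat, fmap_comp, <- !comp_assoc, pres_nat.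
reflexivity.
Qed.
Next Obligation.
simpl; rewrite dagm_comp, comp_assoc, <- fmap_comp, pres_iota, fmap_comp.
rewrite <- comp_assoc, pres_nat, !comp_assoc, pres_iota; reflexivity.
Qed.

Record Achiral (I J : InvolutiveCategory) (F G : InvolutiveFunctor I J) := {
  acomp :> forall X : I, @hom J (F X) (G X);
  acomp_nat : forall (X Y : I) (f : hom X Y),
    fmap F f ;; acomp Y = acomp X ;; fmap G f;
  achiral1 : forall X : I,
    iso_to (pres F (X^†)) =
      acomp (X^†^†) ;; pres G (X^†) ;; dagm (acomp (X^†));
  achiral2 : forall X : I,
    dagm (pres F X) =
      dagm (dagm (acomp X)) ;; dagm (pres G X) ;; dagm (acomp (X^†))
}.

(** The preservator axiom holds at every object, since every object is
    isomorphic to its double dagger. *)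
Lemma achiral_all (I J : InvolutiveCategory) (F G : InvolutiveFunctor I J)
    (s : Achiral F G) (X : I) :
  iso_to (pres F X) = s (X^†) ;; pres G X ;; dagm (s X).
Proof.
set (i := iso_to (iota X)).
assert (key : fmap F (dagm i) ;; iso_to (pres F X)
  = fmap F (dagm i) ;; (s (X^†) ;; pres G X ;; dagm (s X))).
{ rewrite pres_nat, (achiral1 s (X^†)), <- !comp_assoc.
  rewrite <- dagm_comp, acomp_nat, dagm_comp.
  rewrite (comp_assoc (iso_to (pres G _))), <- pres_nat, !comp_assoc.
  rewrite <- acomp_nat; reflexivity. }
set (j := dagm (iso_from (iota X))).
assert (ji : j ;; dagm i = idm _).
{ unfold j, i; rewrite <- dagm_comp, iso_to_from; apply dagm_id. }
rewrite <- (id_comp (iso_to (pres F X))), <- fmap_id, <- ji, fmap_comp.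
rewrite <- comp_assoc, key, comp_assoc, <- fmap_comp, ji, fmap_id.
apply id_comp.
Qed.

(** Conversely, [achiral2] is the dagger of the preservator axiom at [X]. *)
Program Definition Achiral_of (I J : InvolutiveCategory)
    (F G : InvolutiveFunctor I J) (s : forall X : I, @hom J (F X) (G X))
    (s_nat : forall (X Y : I) (f : hom X Y),
      fmap F f ;; s Y = s X ;; fmap G f)
    (s_pres : forall X : I,
      iso_to (pres F X) = s (X^†) ;; pres G X ;; dagm (s X)) : Achiral F G :=
  {| acomp := s; acomp_nat := s_nat |}.
Next Obligation. apply s_pres. Qed.
Next Obligation.
simpl; rewrite s_pres, !dagm_comp, <- !comp_assoc; reflexivity.
Qed.

Lemma achiral_eq (I J : InvolutiveCategory) (F G : InvolutiveFunctor I J)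
    (s t : Achiral F G) : (forall X, s X = t X) -> s = t.
Proof.
intros e; destruct s as [s s1 s2 s3], t as [t t1 t2 t3]; simpl in e.
assert (s = t) by (extensionality X; apply e); subst t.
f_equal; apply proof_irrelevance.
Qed.

Program Definition id_achiral (I J : InvolutiveCategory)
    (F : InvolutiveFunctor I J) : Achiral F F :=
  @Achiral_of I J F F (fun X => idm (F X)) _ _.
Next Obligation. simpl; rewrite comp_id, id_comp; reflexivity. Qed.
Next Obligation. simpl; rewrite dagm_id, comp_id, id_comp; reflexivity. Qed.

Program Definition vcomp_achiral (I J : InvolutiveCategory)
    (F G H : InvolutiveFunctor I J) (s : Achiral F G) (t : Achiral G H) :
    Achiral F H :=
  @Achiral_of I J F H (fun X => s X ;; t X) _ _.
Next Obligation.
simpl; rewrite comp_assoc, acomp_nat, <- !comp_assoc, acomp_nat; reflexivity.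
Qed.
Next Obligation.
simpl; rewrite (achiral_all s), (achiral_all t), dagm_comp, !comp_assoc; reflexivity.
Qed.

Program Definition hcomp_achiral (I J K : InvolutiveCategory)
    (F F' : InvolutiveFunctor I J) (G G' : InvolutiveFunctor J K)
    (s : Achiral F F') (t : Achiral G G') :
    Achiral (comp_ifun F G) (comp_ifun F' G') :=
  @Achiral_of I K (comp_ifun F G) (comp_ifun F' G')
    (fun X => fmap G (s X) ;; t (F' X)) _ _.
Next Obligation.
simpl; rewrite comp_assoc, <- fmap_comp, (acomp_nat s), fmap_comp, <- !comp_assoc.
rewrite (acomp_nat t); reflexivity.
Qed.
Next Obligation.
simpl; rewrite (achiral_all s), !fmap_comp, dagm_comp, <- !comp_assoc.
rewrite (pres_nat G (s X)), (achiral_all t (F' X)), !comp_assoc.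
rewrite <- (comp_assoc (fmap G (s (X^†)))), acomp_nat, !comp_assoc; reflexivity.
Qed.

Record UnitaryCategory := {
  uicat :> InvolutiveCategory;
  phi : forall X : uicat, @Iso uicat X (X^†);
  phi_dag : forall X : uicat, iso_to (phi (X^†)) = dagm (iso_from (phi X));
  phi_phi : forall X : uicat, phi X ;; phi (X^†) = iota X
}.

(** A unitary category is the same thing as an inner product category, with the
    following inner product; [phi] is recovered as the inner product of
    identities. *)
Definition inner (U : UnitaryCategory) (A B X : U) (f : hom A X) (g : hom B X) :
  @hom U A (B^†) := f ;; phi X ;; dagm g.

Lemma inner_idm (U : UnitaryCategory) (A : U) :
  inner (idm A) (idm A) = phi A.
Proof. unfold inner; rewrite dagm_id, id_comp; apply comp_id. Qed.

Record UnitaryFunctor (U V : UnitaryCategory) := {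
  uifun :> InvolutiveFunctor U V;
  ufun_phi : forall X : U,
    fmap uifun (phi X) ;; pres uifun X = phi (uifun X)
}.

Program Definition id_ufun (U : UnitaryCategory) : UnitaryFunctor U U :=
  {| uifun := id_ifun U |}.
Next Obligation. apply comp_id. Qed.

Program Definition comp_ufun (U V W : UnitaryCategory)
    (F : UnitaryFunctor U V) (G : UnitaryFunctor V W) : UnitaryFunctor U W :=
  {| uifun := comp_ifun F G |}.
Next Obligation.
simpl; rewrite comp_assoc, <- fmap_comp, ufun_phi; apply ufun_phi.
Qed.

Lemma ufun_eq (U V : UnitaryCategory) (F G : UnitaryFunctor U V)
    (eo : forall X, F X = G X)
    (em : forall (X Y : U) (f : hom X Y),
      cast2 (@hom V) (eo X) (eo Y) (fmap F f) = fmap G f)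
    (ep : forall X : U,
      cast2 (@hom V) (eo (X^†)) (f_equal (fobj dag) (eo X)) (pres F X)
      = pres G X) :
  F = G.
Proof.
destruct F as [[[o m m1 m2] p p1 p2] u], G as [[[o' m' m1' m2'] p' p1' p2'] u'].
simpl in *.
assert (o = o') by (extensionality X; apply eo); subst o'.
assert (m = m').
{ extensionality X; extensionality Y; extensionality f.
  rewrite <- (em X Y f), cast2_id; reflexivity. }
subst m'.
rewrite (proof_irrelevance _ m1' m1), (proof_irrelevance _ m2' m2) in *.
clear m1' m2'.
assert (p = p').
{ extensionality X; apply iso_eq; rewrite <- (ep X), cast2_id; reflexivity. }
subst p'.
rewrite (proof_irrelevance _ p1' p1), (proof_irrelevance _ p2' p2) in *.
f_equal; apply proof_irrelevance.
Qed.

Program Definition UnitaryHom (U V : UnitaryCategory) : Category :=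
  {| ob := UnitaryFunctor U V;
     hom := fun F G => Achiral F G;
     idm := fun F => id_achiral F;
     comp := fun _ _ _ s t => vcomp_achiral s t |}.
Next Obligation. apply achiral_eq; intros X; apply comp_assoc. Qed.
Next Obligation. apply achiral_eq; intros X; apply id_comp. Qed.
Next Obligation. apply achiral_eq; intros X; apply comp_id. Qed.

Lemma achiral_cast (U V : UnitaryCategory) (F F' G G' : UnitaryHom U V)
    (p : F = F') (q : G = G') (s : hom F G) (t : hom F' G')
    (e : forall (X : U) (p' : fobj (uifun F) X = fobj (uifun F') X)
           (q' : fobj (uifun G) X = fobj (uifun G') X),
         cast2 (@hom V) p' q' (acomp s X) = acomp t X) :
  cast2 (@hom (UnitaryHom U V)) p q s = t.
Proof.
destruct p, q; apply achiral_eq; intros X; exact (e X eq_refl eq_refl).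
Qed.

Program Definition unitary_hcomp (U V W : UnitaryCategory) :
    Functor (prod_cat (UnitaryHom U V) (UnitaryHom V W)) (UnitaryHom U W) :=
  {| fobj := fun FG => comp_ufun (fst FG) (snd FG);
     fmap := fun _ _ s => hcomp_achiral (fst s) (snd s) |}.
Next Obligation.
apply achiral_eq; intros X; simpl; rewrite fmap_id; apply comp_id.
Qed.
Next Obligation.
apply achiral_eq; intros X; simpl; rewrite fmap_comp, !comp_assoc.
f_equal; rewrite <- !comp_assoc; f_equal; apply (acomp_nat (snd f)).
Qed.

Program Definition UnitaryTwoCat : TwoCategory :=
  {| ob2 := UnitaryCategory;
     hom2 := UnitaryHom;
     id2 := id_ufun;
     hcomp2 := unitary_hcomp |}.
Next Obligation.
refine (@ufun_eq A D (comp_ufun (comp_ufun f g) h)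
  (comp_ufun f (comp_ufun g h)) (fun _ => eq_refl) _ _); intros; simpl; trivial.
rewrite fmap_comp, comp_assoc; reflexivity.
Qed.
Next Obligation.
refine (@ufun_eq A B (comp_ufun (id_ufun A) f) f (fun _ => eq_refl) _ _);
  intros; simpl; trivial.
rewrite fmap_id; apply id_comp.
Qed.
Next Obligation.
refine (@ufun_eq A B (comp_ufun f (id_ufun B)) f (fun _ => eq_refl) _ _);
  intros; simpl; trivial.
apply comp_id.
Qed.
Next Obligation.
apply achiral_cast; intros X e1 e2.
etransitivity; [apply cast2_id|]; simpl.
rewrite fmap_comp, comp_assoc; reflexivity.
Qed.
Next Obligation.
apply achiral_cast; intros X e1 e2.
etransitivity; [apply cast2_id|]; simpl; rewrite ?fmap_id; apply id_comp.
Qed.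
Next Obligation.
apply achiral_cast; intros X e1 e2.
etransitivity; [apply cast2_id|]; simpl; apply comp_id.
Qed.

Definition is_dagger_category (I : InvolutiveCategory) : Prop :=
  (forall X : I, X^† = X) /\ (forall X : I, is_identity (iota X)).

Definition is_dagger_unitary (U : UnitaryCategory) : Prop :=
  is_dagger_category U /\ (forall X : U, is_identity (phi X)).

Definition DagCat : TwoCategory :=
  @full_sub2cat UnitaryTwoCat is_dagger_unitary.

Definition DagCat_incl : TwoFunctor DagCat UnitaryTwoCat :=
  @full_sub2cat_incl UnitaryTwoCat is_dagger_unitary.

(* Main.v *)
(** Transporting the dagger of a unitary category along [phi] gives a dagger
    category with the same underlying category. The identity functor with
    preservator [phi] is a unitary isomorphism from it to the original category,
    and these isomorphisms are strictly 2-natural: the unitarity of a functor and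
    the achirality of a transformation say precisely that it is compatible with
    the transported daggers. *)

Require Import Defs.

Set Implicit Arguments.
Unset Strict Implicit.
Unset Printing Implicit Defensive.

#[local] Obligation Tactic := intros.

(** * The dagger transported along [phi], and the resulting dagger category *)

Section Strictification.
Variable U : UnitaryCategory.

Lemma phi_fromK (X Y : U) (f : hom (X^†) Y) :
  iso_from (phi X) ;; (phi X ;; f) = f.
Proof. rewrite comp_assoc, iso_from_to; apply id_comp. Qed.

(** Hermitian symmetry of the form [phi X]: once [iota X] is split as [phi X ;; phi (X^†)], the
    second factor is the dagger of the inverse of [phi X] and cancels. *)
Lemma iota_dagm_phi (X : U) : iota X ;; dagm (phi X) = phi X.
Proof.
rewrite <- phi_phi, phi_dag, <- comp_assoc, <- dagm_comp, iso_to_from, dagm_id.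
apply comp_id.
Qed.

(** The adjoint of [f] for the inner product: the only [g] with
    [inner g (idm X) = inner (idm Y) f]. *)
Definition sdagm (X Y : U) (f : hom X Y) : hom Y X :=
  phi Y ;; dagm f ;; iso_from (phi X).

Lemma sdagm_phi (X Y : U) (f : hom X Y) : sdagm f ;; phi X = phi Y ;; dagm f.
Proof.
unfold sdagm; rewrite <- comp_assoc, iso_from_to; apply comp_id.
Qed.

Lemma sdagm_id (X : U) : sdagm (idm X) = idm X.
Proof. unfold sdagm; rewrite dagm_id, comp_id; apply iso_to_from. Qed.

Lemma sdagm_comp (X Y Z : U) (f : hom X Y) (g : hom Y Z) :
  sdagm (f ;; g) = sdagm g ;; sdagm f.
Proof.
unfold sdagm; rewrite dagm_comp, <- !comp_assoc, phi_fromK; reflexivity.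
Qed.

(** The two outer factors on the left combine to [iota X]; naturality moves it past [f], and
    Hermitian symmetry of [phi Y] cancels the rest. *)
Lemma sdagmK (X Y : U) (f : hom X Y) : sdagm (sdagm f) = f.
Proof.
unfold sdagm; rewrite !dagm_comp, <- phi_dag, !comp_assoc, phi_phi.
change (dagm (dagm f)) with (cmap dag (cmap dag f)).
rewrite <- iota_nat, <- (comp_assoc f), iota_dagm_phi, <- comp_assoc, iso_to_from.
apply comp_id.
Qed.

Definition sdag : Functor (op U) U :=
  @Build_Functor (op U) U (fun X => X) (fun X Y f => @sdagm Y X f)
    sdagm_id (fun X Y Z f g => sdagm_comp g f).

Program Definition strict_icat : InvolutiveCategory :=
  @Build_InvolutiveCategory U sdag (fun X => id_iso X) _ _.
Next Obligation.
simpl; rewrite comp_id, id_comp; symmetry; apply sdagmK.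
Qed.
Next Obligation.
simpl; rewrite id_comp; apply sdagm_id.
Qed.

Program Definition strict_ucat : UnitaryCategory :=
  @Build_UnitaryCategory strict_icat (fun X => @id_iso U X) _ _.
Next Obligation. symmetry; apply sdagm_id. Qed.
Next Obligation. apply id_comp. Qed.

Lemma strict_ucat_dagger : is_dagger_unitary strict_ucat.
Proof. repeat split; intros X; exists eq_refl; reflexivity. Qed.

Definition inv_iso (C : Category) (a b : C) (i : Iso a b) : Iso b a :=
  {| iso_to := iso_from i; iso_from := i;
     iso_to_from := iso_from_to i; iso_from_to := iso_to_from i |}.

Program Definition from_strict_ifun : InvolutiveFunctor strict_icat U :=
  @Build_InvolutiveFunctor strict_icat U (id_functor U) (fun X => phi X) _ _.
Next Obligation. apply sdagm_phi. Qed.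
Next Obligation. simpl; rewrite id_comp; symmetry; apply iota_dagm_phi. Qed.

Program Definition from_strict : UnitaryFunctor strict_ucat U :=
  @Build_UnitaryFunctor strict_ucat U from_strict_ifun _.
Next Obligation. apply id_comp. Qed.

Program Definition to_strict_ifun : InvolutiveFunctor U strict_icat :=
  @Build_InvolutiveFunctor U strict_icat (id_functor U)
    (fun X => inv_iso (phi X)) _ _.
Next Obligation.
(* [strict_icat] has the homs and composition of [U], so the goal can be restated in [U], where the
   laws of [phi] apply. *)
change (dagm f ;; iso_from (phi X) = iso_from (phi Y) ;; sdagm f).
unfold sdagm; rewrite <- !comp_assoc, phi_fromK; reflexivity.
Qed.
Next Obligation.
change (iota X ;; iso_from (phi (X^†)) = idm _ ;; sdagm (iso_from (phi X))).
unfold sdagm; rewrite id_comp, <- phi_dag, phi_phi; reflexivity.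
Qed.

Program Definition to_strict : UnitaryFunctor U strict_ucat :=
  @Build_UnitaryFunctor U strict_ucat to_strict_ifun _.
Next Obligation. apply iso_to_from. Qed.

Lemma from_strictK : comp_ufun from_strict to_strict = id_ufun strict_ucat.
Proof.
refine (@ufun_eq strict_ucat strict_ucat (comp_ufun from_strict to_strict)
  (id_ufun strict_ucat) (fun _ => eq_refl) _ _); intros; simpl; trivial.
apply iso_to_from.
Qed.

Lemma to_strictK : comp_ufun to_strict from_strict = id_ufun U.
Proof.
refine (@ufun_eq U U (comp_ufun to_strict from_strict)
  (id_ufun U) (fun _ => eq_refl) _ _); intros; simpl; trivial.
apply iso_from_to.
Qed.

End Strictification.

(** * Functors and transformations respect the transported daggers *)

(** It suffices to compare after composing with the isomorphism [phi (F X)]. Unitarity factors it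
    through the preservator, whose naturality then finishes. *)
Lemma fmap_sdagm (U V : UnitaryCategory) (F : UnitaryFunctor U V)
    (X Y : U) (f : hom X Y) : fmap F (sdagm f) = sdagm (fmap F f).
Proof.
rewrite <- (comp_id (fmap F (sdagm f))), <- (iso_to_from (phi (F X))).
unfold sdagm at 2; rewrite comp_assoc; f_equal.
rewrite <- !(ufun_phi F), comp_assoc, <- fmap_comp, sdagm_phi, fmap_comp.
rewrite <- !comp_assoc; f_equal; apply pres_nat.
Qed.

(** The components of [s] are isometries: unitarity turns both forms into preservators, and the
    remaining difference is naturality of [s] at [phi X]. *)
Lemma achiral_phi (U V : UnitaryCategory) (F G : UnitaryFunctor U V)
    (s : Achiral F G) (X : U) : s X ;; phi (G X) ;; dagm (s X) = phi (F X).
Proof.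
rewrite <- !ufun_phi, (achiral_all s), !comp_assoc, acomp_nat; reflexivity.
Qed.

(** This is what achirality becomes once all preservators are identities. *)
Lemma achiral_sdagm (U V : UnitaryCategory) (F G : UnitaryFunctor U V)
    (s : Achiral F G) (X : U) : s X ;; sdagm (s X) = idm (F X).
Proof.
unfold sdagm; rewrite !comp_assoc, achiral_phi; apply iso_to_from.
Qed.

Program Definition strict_ifun (U V : UnitaryCategory) (F : UnitaryFunctor U V) :
    InvolutiveFunctor (strict_icat U) (strict_icat V) :=
  @Build_InvolutiveFunctor (strict_icat U) (strict_icat V) (uifun F)
    (fun X => @id_iso V (F X)) _ _.
Next Obligation.
etransitivity; [apply comp_id|]; etransitivity; [|symmetry; apply id_comp].
exact (fmap_sdagm F f).
Qed.
Next Obligation.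
simpl; rewrite fmap_id; f_equal; symmetry; exact (sdagm_id (F X)).
Qed.

Program Definition strict_ufun (U V : UnitaryCategory) (F : UnitaryFunctor U V) :
    UnitaryFunctor (strict_ucat U) (strict_ucat V) :=
  @Build_UnitaryFunctor (strict_ucat U) (strict_ucat V) (strict_ifun F) _.
Next Obligation. simpl; rewrite fmap_id; apply id_comp. Qed.

Program Definition strict_achiral (U V : UnitaryCategory)
    (F G : UnitaryFunctor U V) (s : Achiral F G) :
    Achiral (strict_ufun F) (strict_ufun G) :=
  @Achiral_of (strict_icat U) (strict_icat V) (strict_ufun F) (strict_ufun G)
    (acomp s) (@acomp_nat _ _ _ _ s) _.
Next Obligation.
simpl; rewrite comp_id; symmetry; exact (achiral_sdagm s X).
Qed.

Program Definition strict_hom (U V : UnitaryCategory) :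
    Functor (UnitaryHom U V) (UnitaryHom (strict_ucat U) (strict_ucat V)) :=
  @Build_Functor (UnitaryHom U V) (UnitaryHom (strict_ucat U) (strict_ucat V))
    (fun F => strict_ufun F) (fun F G s => strict_achiral s) _ _.
Next Obligation. apply achiral_eq; reflexivity. Qed.
Next Obligation. apply achiral_eq; reflexivity. Qed.

Lemma strict_ufun_id (U : UnitaryCategory) :
  strict_ufun (id_ufun U) = id_ufun (strict_ucat U).
Proof.
exact (@ufun_eq _ _ (strict_ufun (id_ufun U)) (id_ufun (strict_ucat U))
  (fun _ => eq_refl) (fun _ _ _ => eq_refl) (fun _ => eq_refl)).
Qed.

Lemma strict_ufun_comp (U V W : UnitaryCategory)
    (F : UnitaryFunctor U V) (G : UnitaryFunctor V W) :
  strict_ufun (comp_ufun F G) = comp_ufun (strict_ufun F) (strict_ufun G).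
Proof.
refine (@ufun_eq _ _ (strict_ufun (comp_ufun F G))
  (comp_ufun (strict_ufun F) (strict_ufun G))
  (fun _ => eq_refl) (fun _ _ _ => eq_refl) _).
intros X; simpl; rewrite fmap_id, id_comp; reflexivity.
Qed.

(** Both sides have the same underlying functor; equality of their preservators is exactly unitarity
    of [F]. *)
Lemma from_strict_nat (U V : UnitaryCategory) (F : UnitaryFunctor U V) :
  comp_ufun (strict_ufun F) (from_strict V) = comp_ufun (from_strict U) F.
Proof.
refine (@ufun_eq _ _ (comp_ufun (strict_ufun F) (from_strict V))
  (comp_ufun (from_strict U) F)
  (fun _ => eq_refl) (fun _ _ _ => eq_refl) _).
intros X; simpl; rewrite id_comp; symmetry; apply ufun_phi.
Qed.

Lemma to_strict_nat (U V : UnitaryCategory) (F : UnitaryFunctor U V) :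
  comp_ufun F (to_strict V) = comp_ufun (to_strict U) (strict_ufun F).
Proof.
refine (@ufun_eq _ _ (comp_ufun F (to_strict V))
  (comp_ufun (to_strict U) (strict_ufun F))
  (fun _ => eq_refl) (fun _ _ _ => eq_refl) _).
intros X; simpl; rewrite comp_id.
(* Both sides now end in the inverse of [phi (F X)], which leaves unitarity of [F] with [phi X]
   moved across. *)
rewrite <- (comp_id (fmap F (iso_from (phi X)))), <- (iso_to_from (phi (F X))).
rewrite comp_assoc; f_equal.
rewrite <- (ufun_phi F), comp_assoc, <- fmap_comp, iso_from_to, fmap_id, id_comp.
reflexivity.
Qed.

(** * The strictification 2-functor and the equivalence *)

Program Definition strictification : TwoFunctor UnitaryTwoCat DagCat :=
  @Build_TwoFunctor UnitaryTwoCat DagCat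
    (fun U => exist _ (strict_ucat U) (strict_ucat_dagger U))
    (fun U V => strict_hom U V)
    strict_ufun_id strict_ufun_comp _.
Next Obligation.
(* The object maps agree definitionally, so [e1] and [e2] are loops and the transport is trivial by
   proof irrelevance. *)
apply achiral_cast; intros X e1 e2; apply cast2_id.
Qed.

Program Definition from_strict_trans :
    TwoNatTrans (comp_2functor strictification DagCat_incl)
      (id_2functor UnitaryTwoCat) :=
  @Build_TwoNatTrans UnitaryTwoCat UnitaryTwoCat
    (comp_2functor strictification DagCat_incl) (id_2functor UnitaryTwoCat)
    from_strict from_strict_nat _.
Next Obligation.
apply achiral_cast; intros X e1 e2; etransitivity; [apply cast2_id|].
simpl; rewrite fmap_id, id_comp, comp_id; reflexivity.
Qed.

Program Definition to_strict_trans :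
    TwoNatTrans (id_2functor UnitaryTwoCat)
      (comp_2functor strictification DagCat_incl) :=
  @Build_TwoNatTrans UnitaryTwoCat UnitaryTwoCat
    (id_2functor UnitaryTwoCat) (comp_2functor strictification DagCat_incl)
    to_strict to_strict_nat _.
Next Obligation.
apply achiral_cast; intros X e1 e2; etransitivity; [apply cast2_id|].
simpl; rewrite fmap_id, id_comp, comp_id; reflexivity.
Qed.

(** Since the inclusion is the identity on 1-cells and 2-cells, the components
    at dagger categories of the two transformations above serve for the unit. *)
Definition to_strict_dag_trans :
    TwoNatTrans (id_2functor DagCat) (comp_2functor DagCat_incl strictification) :=
  @Build_TwoNatTrans DagCat DagCat
    (id_2functor DagCat) (comp_2functor DagCat_incl strictification)
    (fun A => to_strict_trans (proj1_sig A))
    (fun A B => @nat1 _ _ _ _ to_strict_trans (proj1_sig A) (proj1_sig B))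
    (fun A B => @nat2 _ _ _ _ to_strict_trans (proj1_sig A) (proj1_sig B)).

Definition from_strict_dag_trans :
    TwoNatTrans (comp_2functor DagCat_incl strictification) (id_2functor DagCat) :=
  @Build_TwoNatTrans DagCat DagCat
    (comp_2functor DagCat_incl strictification) (id_2functor DagCat)
    (fun A => from_strict_trans (proj1_sig A))
    (fun A B => @nat1 _ _ _ _ from_strict_trans (proj1_sig A) (proj1_sig B))
    (fun A B => @nat2 _ _ _ _ from_strict_trans (proj1_sig A) (proj1_sig B)).

Theorem proposition4p12 : is_2equivalence DagCat_incl.
Proof.
(* Unit and counit run in opposite directions, so each is inverted by the family of the other
   kind. *)
exists strictification, to_strict_dag_trans, from_strict_trans; split.
- exists from_strict_dag_trans; intros A.
  exact (conj (to_strictK (proj1_sig A)) (from_strictK (proj1_sig A))).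
- exists to_strict_trans; intros U.
  exact (conj (from_strictK U) (to_strictK U)).
Qed.
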